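(* Let $\sigma=\{\sigma_i \mid i\in I\}$ be a partition of the set of all primes and let $G$ be a finite group. Suppose that $A_{1}$ is a $\sigma$-soluble subgroup of $G$ and that $A_{2}$ and $A_{3}$ are generalized $\sigma$-soluble subgroups of $G$. If the three indices $|G:A_{1}|$, $|G:A_{2}|$, $|G:A_{3}|$ are pairwise $\sigma$-coprime, then $G$ is generalized $\sigma$-soluble.
   Context: All groups are finite. $\sigma=\{\sigma_i\mid i\in I\}$ is a partition of the set of all primes. For a positive integer $n$, $\pi(n)$ is the set of primes dividing $n$ and $\sigma(n)=\{\sigma_i \mid \sigma_i\cap\pi(n)\neq\emptyset\}$; for a group $G$, $\sigma(G)=\sigma(|G|)$. Integers $n$ and $m$ are $\sigma$-coprime if $\sigma(n)\cap\sigma(m)=\emptyset$. A set $\mathcal{H}$ of subgroups of $G$ is a complete Hall $\sigma$-set of $G$ if every member $\neq 1$ of $\mathcal{H}$ is a Hall $\sigma_i$-subgroup of $G$ for some $\sigma_i\in\sigma$, and $\mathcal{H}$ contains exactly one Hall $\sigma_i$-subgroup of $G$ for every $\sigma_i\in\sigma(G)$. $G$ is $\sigma$-full if it possesses a complete Hall $\sigma$-set. $G$ is $\sigma$-soluble if $|\sigma(H/K)|=1$ for every chief factor $H/K$ of $G$. $G$ is generalized $\sigma$-soluble if $G$ is $\sigma$-full and $|\sigma(H/K)|\leq 2$ for every chief factor $H/K$ of $G$. *)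

(* Defs.v *)
From mathcomp Require Import all_boot all_fingroup all_solvable.
From mathcomp Require Import boolp classical_sets functions cardinality.

Set Implicit Arguments.
Unset Strict Implicit.
Unset Printing Implicit Defensive.

Import GroupScope.
Local Open Scope classical_set_scope.
Local Open Scope card_scope.

(* [classical_sets.partition] asks for nonempty, pairwise disjoint blocks whose
   union is the set of primes; the qualified name avoids [finset.partition]. *)
Definition prime_partition (I : Type) (sigma : I -> set nat) : Prop :=
  classical_sets.partition [set: I] sigma [set p | prime p].

(* sigma(n), as a set of blocks (not of indices). *)
Definition sigma_of (I : Type) (sigma : I -> set nat) (n : nat) : set (set nat) :=
  sigma @` [set i | sigma i `&` [set` \pi(n)] !=set0].

Definition sigma_coprime (I : Type) (sigma : I -> set nat) (n m : nat) : Prop :=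
  sigma_of sigma n `&` sigma_of sigma m = set0.

Definition hall_block (gT : finGroupType) (B : set nat) (G H : {group gT}) : bool :=
  [pred p in B].-Hall(G) H.

Definition complete_Hall_sigma_set (I : Type) (sigma : I -> set nat)
    (gT : finGroupType) (G : {group gT}) (HH : {set {group gT}}) : Prop :=
  [/\ forall H : {group gT}, H \in HH -> H \subset G,
      forall H : {group gT}, H \in HH -> H :!=: 1 ->
        exists i, hall_block (sigma i) G H
    & forall B, sigma_of sigma #|G| B ->
        exists! H : {group gT}, H \in HH /\ hall_block B G H].

Definition sigma_full (I : Type) (sigma : I -> set nat)
    (gT : finGroupType) (G : {group gT}) : Prop :=
  exists HH : {set {group gT}}, complete_Hall_sigma_set sigma G HH.

(* [chief_factor G K H] reads "H / K is a chief factor of G". *)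
Definition sigma_soluble (I : Type) (sigma : I -> set nat)
    (gT : finGroupType) (G : {group gT}) : Prop :=
  forall H K : {group gT}, chief_factor G K H ->
    sigma_of sigma #|H / K| #= `I_1.

Definition generalized_sigma_soluble (I : Type) (sigma : I -> set nat)
    (gT : finGroupType) (G : {group gT}) : Prop :=
  sigma_full sigma G /\
  forall H K : {group gT}, chief_factor G K H ->
    sigma_of sigma #|H / K| #<= `I_2.

(* Main.v *)
(* Let H/K be a chief factor of G and work modulo K, so that H is a minimal normal
   subgroup.  If A1 and H meet trivially, then |H| divides |G : A1| and is therefore
   coprime to |G : A2|, so H lies in A2.  Otherwise A1 normalises a minimal subgroup
   N of the intersection of A1 and H; N involves a single block of sigma, so |N| is
   coprime to one of |G : A2| and |G : A3|, say the first, whence N lies in A2, and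
   since G = A2 A1 so does its normal closure H.  In either case H is contained in
   some Aj with j > 1, and as H is generated by the conjugates of a minimal normal
   subgroup of Aj, it involves no other primes than that subgroup does.
   Each block of sigma is avoided by |G : A2| or by |G : A3|, so a Hall subgroup of
   A2 or of A3 for this block is one of G. *)
Require Import Defs.
From mathcomp Require Import boolp classical_sets functions cardinality.
From mathcomp Require Import all_boot all_fingroup all_solvable.

Set Implicit Arguments.
Unset Strict Implicit.
Unset Printing Implicit Defensive.

Import GroupScope.

(** * Minimal normal subgroups and subgroups of coprime index *)

Lemma not_coprime_common_prime (n m : nat) : 0 < n -> 0 < m -> ~~ coprime n m ->
  exists2 p, p \in \pi(n) & p \in \pi(m).
Proof.
move=> n0 m0; rewrite coprime_has_primes // negbK => /hasP[p pm pn].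
by exists p.
Qed.

(* Minimality of [H] forces it to equal its [pi(M)]-core, which is normalised by
   [G] and contains [M]. *)
Lemma minnormal_pi_sub (gT : finGroupType) (G H M : {group gT}) :
  minnormal H G -> M :!=: 1 -> M <| H -> {subset \pi(H) <= \pi(M)}.
Proof.
case/mingroupP=> /andP[_ nHG] minH ntM nMH.
have sMO : M \subset 'O_\pi(M)(H) by rewrite pcore_max ?pgroup_pi.
have OH : 'O_\pi(M)(H) = H.
  apply: minH; last exact: pcore_sub.
  rewrite (char_norm_trans (pcore_char _ _) nHG) andbT.
  by apply: contraNneq ntM => O1; rewrite -subG1 -O1.
have piH : \pi(M).-group H by rewrite -OH pcore_pgroup.
by move=> p piHp; apply: (pnatPpi piH).
Qed.

(** Coprime indices give [G = H * A], so [|G : H|] equals the index in [A] of [A :&: H]. The index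
    of [N :&: H] in [N] divides that number, because [N (A :&: H)] is a subgroup of [A], and it
    divides [|N|]; hence it is 1. *)
Lemma coprime_index_normal_sub (gT : finGroupType) (A G H N : {group gT}) :
    A \subset G -> H \subset G -> N <| A ->
    coprime #|G : A| #|G : H| -> coprime #|N| #|G : H| -> N \subset H.
Proof.
move=> sAG sHG /andP[sNA nNA] coAH coNH.
have nNI : A :&: H \subset 'N(N) by rewrite (subset_trans (subsetIl _ _)).
have HA : H * A = G by apply: coprime_index_mulG; rewrite // coprime_sym.
have idx : #|A : A :&: H| = #|G : H| by rewrite indexgI -HA indexMg.
rewrite -indexg_eq1 -dvdn1 -(eqP coNH) dvdn_gcd dvdn_indexg /= -idx.
have -> : #|N : H| = #|N : A :&: H|.
  by rewrite -[LHS]indexgI -[RHS]indexgI setIA (setIidPl sNA).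
rewrite -(indexMg (A :&: H)) -norm_joinEl // indexSg ?joing_subl //.
by rewrite join_subG sNA subsetIl.
Qed.

(** Carries what is known of the chief factors of [A] over to [A / K], although [K] need not lie in
    [A]: take for [U] the preimage of [M] in [A], for [V] the group [K :&: U], and apply the second
    isomorphism theorem. *)
Lemma minnormal_chief_factor (gT : finGroupType) (A K : {group gT})
    (M : {group coset_of K}) :
    A \subset 'N(K) -> minnormal M (A / K) -> M \subset A / K ->
  exists V U : {group gT}, chief_factor A V U /\ #|U / V| = #|M|.
Proof.
move=> nKA /mingroupP[/andP[ntM nMA] minM] sMA.
pose U := (A :&: coset K @*^-1 M)%G.
have sUA : U \subset A by apply: subsetIl.
have nKU : U \subset 'N(K) := subset_trans sUA nKA.
have UK : U / K = M by rewrite quotient_setIpre; apply/setIidPr.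
have nUA : A \subset 'N(U).
  rewrite normsI ?normG // (subset_trans _ (morphpre_norm _ _)) //.
  by rewrite -sub_quotient_pre.
exists (K :&: U)%G, U; split; last first.
  by rewrite (card_isog (second_isog nKU)) -UK.
rewrite /chief_factor /(U <| A) sUA nUA !andbT.
apply/maxgroupP; split.
  rewrite properE subsetIr subsetI subxx andbT normsI // andbT.
  by apply: contra ntM => sUK; rewrite -UK quotientS1.
move=> V /andP[/properP[sVU [x Ux V'x]] nVA] sKUV.
apply/eqP; rewrite eqEsubset sKUV subsetI sVU andbT.
have nKV := subset_trans sVU nKU.
(* Were [V] not inside [K], its image would be all of [M] by minimality. Then [x] agrees modulo [K]
   with some [y] in [V], and [x * y^-1] lies in [K :&: U], hence in [V], which puts [x] in [V]. *)
rewrite andbT -quotient_sub1 //; apply: contraR V'x => ntVK.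
have VK : V / K = M.
  apply: minM; last by rewrite -UK quotientS.
  by rewrite -subG1 ntVK quotient_norms.
have: coset K x \in V / K by rewrite VK -UK mem_quotient.
case/morphimP=> y nKy Vy /(rcoset_kercosetP (subsetP nKU x Ux) nKy) Kxy.
rewrite -(mulgKV y x) groupM // (subsetP sKUV) // inE.
by rewrite -mem_rcoset Kxy groupM ?groupV // (subsetP sVU).
Qed.

(* As [G = A2 A1] and [A1] normalises [N], every [G]-conjugate of [A2] contains
   [N], so the normal core of [A2] meets [H] nontrivially. *)
Lemma minnormal_sub_of_normal_sub (gT : finGroupType) (G A1 A2 H N : {group gT}) :
    minnormal H G -> A2 * A1 = G -> N :!=: 1 -> N \subset H -> N \subset A2 ->
    A1 \subset 'N(N) -> H \subset A2.
Proof.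
case/mingroupP=> /andP[_ nHG] minH defG ntN sNH sNA2 nNA1.
have sNcore : N \subset gcore A2 G.
  apply/bigcapsP=> x; rewrite -defG => /mulsgP[a b Aa Bb ->].
  by rewrite conjsgM (conjGid Aa) -(normsP nNA1 b Bb) conjSg.
have sN : N \subset H :&: gcore A2 G by rewrite subsetI sNH.
have <- : H :&: gcore A2 G = H.
  apply: (minH (H :&: gcore_group A2 G)%G); last exact: subsetIl.
  rewrite normsI ?gcore_norm // andbT.
  by apply: contraNneq ntN => I1; rewrite -subG1 -I1.
by rewrite subIset // gcore_sub orbT.
Qed.

Lemma minnormal_sub_of_coprime_index (gT : finGroupType)
    (G A1 A2 A3 H : {group gT}) :
    A1 \subset G -> A2 \subset G -> A3 \subset G -> H \subset G ->
    minnormal H G ->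
    coprime #|G : A1| #|G : A2| -> coprime #|G : A1| #|G : A3| ->
    (forall N : {group gT}, minnormal N A1 -> N \subset A1 ->
      coprime #|N| #|G : A2| \/ coprime #|N| #|G : A3|) ->
  H \subset A2 \/ H \subset A3.
Proof.
move=> sA1G sA2G sA3G sHG minH co12 co13 coN.
have nHG : G \subset 'N(H) by case/mingroupP: minH => /andP[].
have [I1 | ntI] := eqVneq (A1 :&: H) 1.
  (* Here [G] itself plays the part of [A], so one of the two indices is 1. For the other condition,
     [|H|] is the index of [A1] in [A1 H] and so divides [|G : A1|]. *)
  left; apply: (@coprime_index_normal_sub _ G G) => //.
  - by rewrite /normal sHG.
  - by rewrite indexgg coprime1n.
  apply: coprime_dvdl co12; rewrite -(indexg1 H) -I1 setIC indexgI.
  rewrite -(indexMg A1) -norm_joinEl ?(subset_trans sA1G) //.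
  by rewrite indexSg ?joing_subl // join_subG sA1G.
have nIA1 : A1 \subset 'N(A1 :&: H) by rewrite normsI ?normG ?(subset_trans sA1G).
have [N minN] := minnormal_exists ntI nIA1; rewrite subsetI => /andP[sNA1 sNH].
have [/andP[ntN nNA1] _] := mingroupP minN.
have nsNA1 : N <| A1 by rewrite /normal sNA1.
have in_A (A : {group gT}) : A \subset G -> coprime #|G : A1| #|G : A| ->
    coprime #|N| #|G : A| -> H \subset A.
  move=> sAG coA coNA.
  have defG : A * A1 = G by apply: coprime_index_mulG; rewrite // coprime_sym.
  have sNA : N \subset A := coprime_index_normal_sub sA1G sAG nsNA1 coA coNA.
  exact: minnormal_sub_of_normal_sub minH defG ntN sNH sNA nNA1.
by case: (coN N minN sNA1); [left | right]; apply: in_A.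
Qed.

Local Open Scope classical_set_scope.
Local Open Scope card_scope.

(** * Blocks of [sigma] and coprimality *)

Section SigmaOf.
Variables (I : Type) (sigma : I -> set nat).

Lemma sigma_of_sub (n m : nat) :
  {subset \pi(n) <= \pi(m)} -> sigma_of sigma n `<=` sigma_of sigma m.
Proof.
move=> pi_nm _ [i [p [sp np]] <-]; exists i => //.
by exists p; split=> //; apply: pi_nm.
Qed.

Hypothesis sigmaP : prime_partition sigma.

Lemma sigma_block_of_prime (p : nat) : prime p -> exists i, sigma i p.
Proof.
case: sigmaP => covs _ _ pr_p.
have [i _ ip] : (\bigcup_(i in [set: I]) sigma i) p by rewrite [X in X p]covs.
by exists i.
Qed.

Lemma sigma_block_inj (i j : I) (p : nat) : sigma i p -> sigma j p -> i = j.
Proof. by case: sigmaP => _ tI _ ip jp; apply: tI => //; exists p. Qed.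

Lemma sigma_ofP (n p : nat) (i : I) :
  p \in \pi(n) -> sigma i p -> sigma_of sigma n (sigma i).
Proof. by move=> np ip; exists i => //; exists p. Qed.

Lemma sigma_of_block (n : nat) (i : I) :
  sigma_of sigma n (sigma i) -> exists2 p, p \in \pi(n) & sigma i p.
Proof. by case=> j [q [jq nq]] <-; exists q. Qed.

Lemma sigma_coprime_coprime (n m : nat) :
  0 < n -> 0 < m -> sigma_coprime sigma n m -> coprime n m.
Proof.
move=> n0 m0 co; apply/negPn/negP=> /not_coprime_common_prime[] // p pn pm.
have [i ip] : exists i, sigma i p.
  by apply: sigma_block_of_prime; move: pn; rewrite mem_primes => /andP[].
suff: (sigma_of sigma n `&` sigma_of sigma m) (sigma i) by rewrite co.
by split; apply: sigma_ofP ip.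
Qed.

(** A prime shared by [k] and [n] and a prime shared by [k] and [m] would both lie in the only block
    of [k], which would then belong to [n] and [m] alike. *)
Lemma card_sigma_of_coprime (k n m : nat) :
    0 < k -> 0 < n -> 0 < m -> sigma_of sigma k #= `I_1 ->
    sigma_coprime sigma n m -> coprime k n \/ coprime k m.
Proof.
move=> k0 n0 m0 k1 co.
have [//|/not_coprime_common_prime[] // p pk pn] :=
  boolP (coprime k n); first by left.
have [//|/not_coprime_common_prime[] // q qk qm] :=
  boolP (coprime k m); first by right.
have blk r : r \in \pi(k) -> exists i, sigma i r.
  by rewrite mem_primes => /andP[pr_r _]; apply: sigma_block_of_prime.
have [[i ip] [j jq]] := (blk p pk, blk q qk).
have eq_ij : sigma i = sigma j.
  have /card_set_bijP[f [funf injf _]] := k1.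
  have f0 B : sigma_of sigma k B -> f B = 0%N by move=> /funf /=; case: (f B).
  have [ki kj] := (sigma_ofP pk ip, sigma_ofP qk jq).
  by apply: injf; rewrite ?f0 //; apply: mem_set.
suff: (sigma_of sigma n `&` sigma_of sigma m) (sigma i) by rewrite co.
by split; [apply: sigma_ofP ip | rewrite eq_ij; apply: sigma_ofP jq].
Qed.

(** * Chief factors of [G] *)

Lemma chief_factor_sigma_of_le (gT : finGroupType) (G A1 A2 A3 H K : {group gT}) :
    A1 \subset G -> A2 \subset G -> A3 \subset G ->
    sigma_soluble sigma A1 ->
    (forall U V : {group gT}, chief_factor A2 V U ->
       sigma_of sigma #|U / V| #<= `I_2) ->
    (forall U V : {group gT}, chief_factor A3 V U ->
       sigma_of sigma #|U / V| #<= `I_2) ->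
    sigma_coprime sigma #|G : A1| #|G : A2| ->
    sigma_coprime sigma #|G : A1| #|G : A3| ->
    sigma_coprime sigma #|G : A2| #|G : A3| ->
  chief_factor G K H -> sigma_of sigma #|H / K| #<= `I_2.
Proof.
move=> sA1G sA2G sA3G solA1 leA2 leA3 co12 co13 co23 chiefHK.
have nKG : G \subset 'N(K) by case/andP: chiefHK => /maxgroupp/andP[].
have sHG : H \subset G by case/andP: chiefHK => _ /andP[].
have minH := chief_factor_minnormal chiefHK.
have dvq (A : {group gT}) : A \subset G -> #|G / K : A / K| %| #|G : A|.
  by move=> sAG; rewrite index_quotient // subIset ?nKG.
have coq (A B : {group gT}) : A \subset G -> B \subset G ->
    sigma_coprime sigma #|G : A| #|G : B| ->
    coprime #|G / K : A / K| #|G / K : B / K|.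
  move=> sAG sBG /sigma_coprime_coprime co.
  apply: (coprime_dvdl (dvq A sAG)); apply: (coprime_dvdr (dvq B sBG)).
  by apply: co; apply: indexg_gt0.
(* A minimal normal subgroup [M] of [A / K] inside [H / K] has the order of a chief factor of [A],
   and being normal in [H / K] it already involves every prime of [H / K]. *)
have below (A : {group gT}) : A \subset G -> H / K \subset A / K ->
    (forall U V : {group gT}, chief_factor A V U ->
       sigma_of sigma #|U / V| #<= `I_2) ->
    sigma_of sigma #|H / K| #<= `I_2.
  move=> sAG sHA leA.
  have [/andP[ntH nHG] _] := mingroupP minH.
  have nHA : A / K \subset 'N(H / K) by rewrite (subset_trans _ nHG) ?quotientS.
  have [M minM sMH] := minnormal_exists ntH nHA.
  have [/andP[ntM nMA] _] := mingroupP minM.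
  have [V [U [chiefUV cardM]]] :=
    minnormal_chief_factor (subset_trans sAG nKG) minM (subset_trans sMH sHA).
  apply: (card_le_trans _ (leA U V chiefUV)); apply: subset_card_le.
  apply: sigma_of_sub; rewrite cardM; apply: (minnormal_pi_sub minH ntM).
  by rewrite /normal sMH (subset_trans sHA).
have coN (N : {group coset_of K}) : minnormal N (A1 / K) -> N \subset A1 / K ->
    coprime #|N| #|G / K : A2 / K| \/ coprime #|N| #|G / K : A3 / K|.
  move=> minN sNA1.
  have [V [U [/solA1 + <-]]] :=
    minnormal_chief_factor (subset_trans sA1G nKG) minN sNA1.
  move=> /(card_sigma_of_coprime (cardG_gt0 _) (indexg_gt0 _ _)
            (indexg_gt0 _ _))/(_ co23).
  by case=> co; [left | right]; apply: coprime_dvdr co; apply: dvq.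
have [sH|sH] := minnormal_sub_of_coprime_index (quotientS K sA1G)
  (quotientS K sA2G) (quotientS K sA3G) (quotientS K sHG) minH
  (coq A1 A2 sA1G sA2G co12) (coq A1 A3 sA1G sA3G co13) coN.
- exact: below sA2G sH leA2.
- exact: below sA3G sH leA3.
Qed.

(** * Hall subgroups and complete Hall sets *)

Lemma hall_block_of_sub (gT : finGroupType) (G A : {group gT}) (B : set nat) :
    A \subset G -> sigma_full sigma A ->
    sigma_of sigma #|G| B -> ~ sigma_of sigma #|G : A| B ->
  exists H : {group gT}, hall_block B G H.
Proof.
move=> sAG [HH [sHH _ hallHH]] GB nB.
have [i iB] : exists i, sigma i = B by case: GB => i _ <-; exists i.
have idxB : [pred p in B]^'.-nat #|G : A|.
  apply/pnatP=> // p pr_p pdv; rewrite !inE /=; apply/negP=> Bp.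
  apply: nB; rewrite -iB; apply: (@sigma_ofP _ p).
    by rewrite mem_primes pr_p indexg_gt0.
  by rewrite iB; apply: set_mem.
(* A prime of [B] dividing [|G|] does not divide [|G : A|], so it divides [|A|], and the Hall set of
   [A] has a member for [B]. *)
have [H [[HHH hallH] _]] : exists! H : {group gT}, H \in HH /\ hall_block B A H.
  have [p pG ip] : exists2 p, p \in \pi(#|G|) & sigma i p.
    by apply: sigma_of_block; rewrite iB.
  apply: hallHH; rewrite -iB.
  apply: (@sigma_ofP _ p) => //; move: pG.
  rewrite -(Lagrange sAG) !mem_primes => /and3P[pr_p _].
  rewrite Euclid_dvdM // pr_p cardG_gt0 /= => /orP[//|pdv].
  move/(pnatP _ (indexg_gt0 _ _))/(_ p pr_p pdv): idxB.
  by rewrite !inE /= -iB => /negP[]; apply: mem_set.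
exists H; have [sHA pH idxH] := and3P hallH.
rewrite /hall_block /pHall (subset_trans sHA sAG) pH /=.
by rewrite -(Lagrange_index sAG sHA) pnatM idxB idxH.
Qed.

Lemma sigma_full_of_hall (gT : finGroupType) (G : {group gT}) :
    (forall B, sigma_of sigma #|G| B -> exists H : {group gT}, hall_block B G H) ->
  sigma_full sigma G.
Proof.
move=> hallG.
have /choice[h hP] : forall B : set nat, exists H : {group gT},
    sigma_of sigma #|G| B -> hall_block B G H.
  move=> B; have [/hallG[H hH]|nB] := pselect (sigma_of sigma #|G| B).
    by exists H.
  (* A default value for the blocks that do not meet [|G|]; [inHH] keeps it out of the Hall set. *)
  by exists 1%G.
pose inHH (H : {group gT}) := exists2 B, sigma_of sigma #|G| B & h B = H.
exists [set H : {group gT} | `[< inHH H >]]%SET; split.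
- by move=> H; rewrite inE => /asboolP[B /hP hB <-]; case/and3P: hB.
- move=> H; rewrite inE => /asboolP[B GB <-] _.
  by have hB := hP B GB; case: GB hB => i _ <-; exists i.
move=> B GB; exists (h B); split.
  by split; [rewrite inE; apply/asboolP; exists B | apply: hP].
move=> H []; rewrite inE => /asboolP[C GC <-] hallC.
(* If [h C], chosen for [C], is also a Hall subgroup for [B], then a prime of [B] dividing [|G|]
   divides [|h C|] and so lies in [C]; disjointness of the blocks gives [B = C]. *)
suff -> : B = C by [].
have [i iB] : exists i, sigma i = B by case: GB => i _ <-; exists i.
have [j jC] : exists j, sigma j = C by case: GC => j _ <-; exists j.
have [p pG ip] : exists2 p, p \in \pi(#|G|) & sigma i p.
  by apply: sigma_of_block; rewrite iB.
have ph : p \in \pi(#|h C|).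
  have [_ _ idxH] := and3P hallC.
  move: pG; rewrite -(Lagrange (pHall_sub hallC)).
  rewrite primesM ?cardG_gt0 ?indexg_gt0 // => /orP[//|pidx].
  by have /negP[] := pnatPpi idxH pidx; rewrite !inE -iB; apply: mem_set.
have jp : sigma j p.
  have [_ Ch _] := and3P (hP C GC).
  by rewrite jC; apply: set_mem; apply: (pnatPpi Ch).
by rewrite -iB -jC (sigma_block_inj ip jp).
Qed.
End SigmaOf.

Theorem corollary1p7 (I : Type) (sigma : I -> set nat)
    (sigmaP : prime_partition sigma)
    (gT : finGroupType) (G A1 A2 A3 : {group gT})
    (sA1G : A1 \subset G) (sA2G : A2 \subset G) (sA3G : A3 \subset G)
    (solA1 : sigma_soluble sigma A1)
    (gsolA2 : generalized_sigma_soluble sigma A2)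
    (gsolA3 : generalized_sigma_soluble sigma A3)
    (co12 : sigma_coprime sigma #|G : A1| #|G : A2|)
    (co13 : sigma_coprime sigma #|G : A1| #|G : A3|)
    (co23 : sigma_coprime sigma #|G : A2| #|G : A3|) :
  generalized_sigma_soluble sigma G.
Proof.
have [[fullA2 leA2] [fullA3 leA3]] := (gsolA2, gsolA3).
split; last by move=> H K; apply: (chief_factor_sigma_of_le sigmaP sA1G sA2G sA3G).
apply: (sigma_full_of_hall sigmaP) => B GB.
have [G2B|nG2B] := pselect (sigma_of sigma #|G : A2| B); last first.
  exact: hall_block_of_sub sA2G fullA2 GB nG2B.
apply: (hall_block_of_sub sA3G fullA3 GB) => G3B.
by suff: (sigma_of sigma #|G : A2| `&` sigma_of sigma #|G : A3|) B by rewrite co23.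
Qed.
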